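(* Let $G=(V^{\mathrm{s}},V^{\mathrm{a}},E)$ be an influence diagram with vertex set $V=V^{\mathrm{s}}\sqcup V^{\mathrm{a}}$, and let $C\subseteq V$. Say that a subset $D\subseteq C$ is policy-invariant if for any parametrization of $G$ there exists a conditional distribution $p_{D|C\setminus D}$ of $X_D$ given $X_{C\setminus D}$ such that $\mathbb{P}_\delta(X_D|X_{C\setminus D})=p_{D|C\setminus D}$ holds for any policy $\delta$. Then the largest (for inclusion) policy-invariant subset $C^{\perp}$ of $C$ exists, is unique, and is equal to $$\Big\{v\in C:\ v\perp\vartheta_{V^{\mathrm{a}}}\mid C\setminus\{v\}\Big\},$$ where $\perp$ denotes d-separation in the augmented graph $G^\dagger$ and $\vartheta_{V^{\mathrm{a}}}=\{\vartheta_w\}_{w\in V^{\mathrm{a}}}$.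
   Context: An influence diagram $G=(V^{\mathrm{s}},V^{\mathrm{a}},E)$ is a finite acyclic digraph with vertex set $V=V^{\mathrm{s}}\sqcup V^{\mathrm{a}}$, where $V^{\mathrm{a}}$ is the set of decision vertices and $V^{\mathrm{s}}$ is the disjoint union of the chance vertices and the utility vertices $V^{\mathrm{r}}$ (utility vertices have no children). $\mathrm{pa}(v)$ denotes the parents of $v$. A parametrization consists of finite nonempty sets $\mathcal{X}_v$ ($v\in V$), conditional distributions $p_{v|\mathrm{pa}(v)}$ on $\mathcal{X}_v$ given $\mathcal{X}_{\mathrm{pa}(v)}$ for $v\in V^{\mathrm{s}}$, and rewards $r_v:\mathcal{X}_v\to\mathbb{R}$ for $v\in V^{\mathrm{r}}$. A policy $\delta=(\delta_{v|\mathrm{pa}(v)})_{v\in V^{\mathrm{a}}}$ is a family of conditional distributions on $\mathcal{X}_v$ given $\mathcal{X}_{\mathrm{pa}(v)}$; it induces $\mathbb{P}_\delta(X_V=x_V)=\prod_{v\in V^{\mathrm{s}}}p_{v|\mathrm{pa}(v)}(x_v|x_{\mathrm{pa}(v)})\prod_{v\in V^{\mathrm{a}}}\delta_{v|\mathrm{pa}(v)}(x_v|x_{\mathrm{pa}(v)})$. The equality $\mathbb{P}_\delta(X_D|X_{C\setminus D})=p_{D|C\setminus D}$ is required at all values $x_{C\setminus D}$ with $\mathbb{P}_\delta(X_{C\setminus D}=x_{C\setminus D})>0$. Augmented graph: $G^\dagger$ is obtained from $(V,E)$ by adding, for each decision vertex $w\in V^{\mathrm{a}}$, a new vertex $\vartheta_w$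 and the arc $(\vartheta_w,w)$. d-separation: a trail $v_1,\dots,v_n$ (consecutive vertices joined by an arc in either direction) is active given a vertex set $D$ if for each v-structure $v_{i-1}\to v_i\leftarrow v_{i+1}$ on it, $v_i$ or one of its descendants is in $D$, and no other vertex of the trail is in $D$. $B_1\perp B_2\mid D$ (d-separation) means that there is no active trail between $B_1$ and $B_2$ given $D$. *)

(* Defs.v *)
From HB Require Import structures.
From mathcomp Require Import all_boot all_order all_algebra.
From mathcomp Require Import boolp reals.

Set Implicit Arguments.
Unset Strict Implicit.
Unset Printing Implicit Defensive.

Import GRing.Theory Num.Theory.

Local Open Scope ring_scope.

(* Chance vertices are those that are neither decisions nor utilities. *)
Record influence_diagram := InfluenceDiagram {
  vertex : finType;
  decision : {set vertex};
  utility : {set vertex};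
  arc : rel vertex;
  arc_acyclic : forall c : seq vertex, cycle arc c -> c = [::];
  utility_nondecision : utility \subset ~: decision;
  utility_childless : forall u v, u \in utility -> ~~ arc u v
}.

Definition nondecision (G : influence_diagram) : {set vertex G} :=
  ~: decision G.

Definition parents (G : influence_diagram) (v : vertex G) : {set vertex G} :=
  [set u | arc u v].

Section Assignments.
Variables (V : finType) (X : V -> finType).

Definition assignment (A : {set V}) : finType :=
  {dffun forall v : {v : V | v \in A}, X (val v)}.

Definition full_assignment : finType := {dffun forall v : V, X v}.

Definition restrict (A : {set V}) (x : full_assignment) : assignment A :=
  [ffun v : {v : V | v \in A} => x (val v)].

End Assignments.

(* [k b a] is the probability of [a : A] given [b : B]. *)
Record cond_dist (R : realType) (A B : finType) := CondDist {
  cond_dist_fun :> B -> A -> R;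
  cond_dist_ge0 : forall b a, 0 <= cond_dist_fun b a;
  cond_dist_sum1 : forall b, \sum_a cond_dist_fun b a = 1
}.

Record parametrization (R : realType) (G : influence_diagram) :=
  Parametrization {
    space : vertex G -> finType;
    space_nonempty : forall v, (0 < #|space v|)%N;
    law : forall v : {v : vertex G | v \in nondecision G},
      cond_dist R (space (val v)) (assignment space (parents (val v)));
    reward : forall v : {v : vertex G | v \in utility G}, space (val v) -> R
  }.

Section Probability.
Variables (R : realType) (G : influence_diagram) (P : parametrization R G).

Definition policy :=
  forall v : {v : vertex G | v \in decision G},
    cond_dist R (space P (val v)) (assignment (space P) (parents (val v))).

Definition joint (delta : policy) (x : full_assignment (space P)) : R :=
  (\prod_(v : {v : vertex G | v \in nondecision G})
     law P v (restrict (parents (val v)) x) (x (val v))) *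
  (\prod_(v : {v : vertex G | v \in decision G})
     delta v (restrict (parents (val v)) x) (x (val v))).

Definition prob (delta : policy) (E : pred (full_assignment (space P))) : R :=
  \sum_(x | E x) joint delta x.

(* Only meaningful when the conditioning event has positive probability. *)
Definition cond_prob (delta : policy)
    (E F : pred (full_assignment (space P))) : R :=
  prob delta (predI E F) / prob delta F.

Definition agrees (A : {set vertex G}) (a : assignment (space P) A) :
    pred (full_assignment (space P)) :=
  [pred x | restrict A x == a].

End Probability.

Definition policy_invariant (R : realType) (G : influence_diagram)
    (C D : {set vertex G}) : Prop :=
  D \subset C /\
  forall P : parametrization R G,
  exists k : cond_dist R (assignment (space P) D)
                         (assignment (space P) (C :\: D)),
  forall (delta : policy P)
         (xD : assignment (space P) D) (xCD : assignment (space P) (C :\: D)),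
    0 < prob delta (agrees xCD) ->
    cond_prob delta (agrees xD) (agrees xCD) = k xCD xD.

Definition largest_policy_invariant (R : realType) (G : influence_diagram)
    (C M : {set vertex G}) : Prop :=
  policy_invariant R C M /\
  forall D : {set vertex G}, policy_invariant R C D -> D \subset M.

Section DSeparation.
Variables (T : finType) (e : rel T).

(* The trail is [x :: p]; its vertices need not be distinct, and the activity
   conditions are imposed position by position. *)
Definition trail (x : T) (p : seq T) : bool :=
  path (fun u v => e u v || e v u) x p.

Definition v_structure (x : T) (p : seq T) (i : nat) : bool :=
  let t := nth x (x :: p) in
  [&& (0 < i)%N, (i < size p)%N, e (t i.-1) (t i) & e (t i.+1) (t i)].

Definition active (D : {set T}) (x : T) (p : seq T) : Prop :=
  forall i : nat, (i <= size p)%N ->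
    let vi := nth x (x :: p) i in
    if v_structure x p i then exists2 d, d \in D & connect e vi d
    else vi \notin D.

Definition d_separated (B1 B2 D : {set T}) : Prop :=
  forall (x : T) (p : seq T),
    x \in B1 -> last x p \in B2 -> trail x p -> ~ active D x p.

End DSeparation.

(* [inr w] is the vertex added as a parent of the decision vertex [w]. *)
Definition augmented_vertex (G : influence_diagram) : finType :=
  (vertex G + {w : vertex G | w \in decision G})%type.

Definition augmented_arc (G : influence_diagram) : rel (augmented_vertex G) :=
  fun a b =>
    match a, b with
    | inl u, inl v => arc u v
    | inr w, inl v => val w == v
    | _, inr _ => false
    end.

Definition original (G : influence_diagram) (A : {set vertex G}) :
    {set augmented_vertex G} :=
  [set inl v | v in A].

Definition theta (G : influence_diagram) : {set augmented_vertex G} :=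
  [set inr w | w : {w : vertex G | w \in decision G}].

Definition Cperp (G : influence_diagram) (C : {set vertex G}) :
    {set vertex G} :=
  [set v in C | `[< d_separated (@augmented_arc G)
                      (original [set v]) (theta G) (original (C :\ v)) >]].

(* Main.v *)
Require Import Defs.
From mathcomp Require Import all_boot all_order all_algebra.
From mathcomp Require Import boolp reals.

Set Implicit Arguments.
Unset Strict Implicit.
Unset Printing Implicit Defensive.

Import Order.TTheory GRing.Theory Num.Theory.

(* Sufficiency.  For M = C^perp, an active walk from M to the policy nodes given
   C \ M, cut at its last non-collider in M, would be active from a single
   vertex of M given the rest of C; so M is separated from the policy nodes by
   Z = C \ M.  After summing out the non-ancestors of C, no mechanism of the
   remaining factorisation involves both the part S reached from M and a vertex
   outside S and Z, and no decision mechanism involves S.  Exchanging the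
   coordinates outside S between two independent samples that agree on Z
   therefore exchanges the policies, which gives
   P_d(m, z) P_d'(z) = P_d'(m, z) P_d(z).

   Necessity.  Given an active walk from v in C to the policy node of some
   decision, let every vertex carry one bit per position of the walk: a bit with
   one parent on the walk copies it, a bit with two parents is their xor, a
   bit without parents is a fair coin, and the policy fixes the parent of the
   last bit to a constant b.  When all colliders are observed to be 0, all other
   bits equal b, so the value of v given the rest of C reveals the policy. *)

(** * Active walks *)

Section Walks.
Variables (T : finType) (e : rel T).

Definition ancestors (D : {set T}) : {set T} :=
  [set u | [exists d in D, connect e u d]].

Lemma ancestorsP (D : {set T}) u :
  reflect (exists2 d, d \in D & connect e u d) (u \in ancestors D).
Proof. by rewrite inE; apply: exists_inP. Qed.

Lemma sub_ancestors (D : {set T}) : D \subset ancestors D.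
Proof. by apply/subsetP => u uD; apply/ancestorsP; exists u. Qed.

Lemma ancestors_arc (D : {set T}) u w :
  e u w -> w \in ancestors D -> u \in ancestors D.
Proof.
move=> uw /ancestorsP[d dD wd]; apply/ancestorsP; exists d => //.
exact: connect_trans (connect1 uw) wd.
Qed.

Lemma ancestorsS (D D' : {set T}) :
  D \subset D' -> ancestors D \subset ancestors D'.
Proof.
move=> sDD'; apply/subsetP => u /ancestorsP[d dD ud].
by apply/ancestorsP; exists d => //; apply: (subsetP sDD').
Qed.

Lemma ancestors_ind (D : {set T}) (Q : T -> Prop) :
  (forall u, u \in D -> Q u) ->
  (forall u w, e u w -> w \in ancestors D -> Q w -> Q u) ->
  forall u, u \in ancestors D -> Q u.
Proof.
move=> Q0 QS u /ancestorsP[d dD /connectP[p]].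
elim: p u => [|w p IH] u /=; first by move=> _ dE; apply: Q0; rewrite -dE.
case/andP=> uw pw dE; apply: QS uw _ (IH _ pw dE).
by apply/ancestorsP; exists d => //; apply/connectP; exists p.
Qed.

(* [reach K D A u b]: some walk from [A] ends in [u], its last arc pointing
   into [u] iff [b]; all its inner colliders lie in [K] and all its other
   vertices except [u] lie outside [D]. *)
Inductive reach (K D A : {set T}) : T -> bool -> Prop :=
| reach_start u : u \in A -> reach K D A u false
| reach_forward u b w : reach K D A u b -> u \notin D -> e u w ->
    reach K D A w true
| reach_backward u w : reach K D A u false -> u \notin D -> e w u ->
    reach K D A w false
| reach_collider u w : reach K D A u true -> u \in K -> e w u ->
    reach K D A w false.

Definition enters (x : T) (p : seq T) : bool :=
  (0 < size p)%N && e (nth x (x :: p) (size p).-1) (last x p).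

(** The end of the walk is left unconstrained, so that walks can grow one arc at a time; [K] is
    separate from [D] to allow colliders in [ancestors D] or in [D] itself. *)
Definition open_inside (K D : {set T}) (x : T) (p : seq T) : Prop :=
  forall i, (i < size p)%N ->
    nth x (x :: p) i \in if v_structure e x p i then K else ~: D.

Lemma open_inside_rcons (K D : {set T}) x p w :
  open_inside K D x (rcons p w) <->
  open_inside K D x p /\
  last x p \in if enters x p && e w (last x p) then K else ~: D.
Proof.
have nthE i : (i <= size p)%N ->
    nth x (x :: rcons p w) i = nth x (x :: p) i.
  by move=> ip; rewrite -rcons_cons nth_rcons /= ltnS ip.
have vE i : (i < size p)%N ->
    v_structure e x (rcons p w) i = v_structure e x p i.
  move=> ip; rewrite /v_structure size_rcons ip ltnS (ltnW ip).
  by rewrite !nthE // ?(ltnW ip) // (leq_trans (leq_pred _) (ltnW ip)).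
have vL : v_structure e x (rcons p w) (size p) = enters x p && e w (last x p).
  rewrite /v_structure size_rcons ltnSn (nthE (size p)) // nthE ?leq_pred //.
  rewrite /= nth_rcons ltnn eqxx /enters -andbA.
  by rewrite -[last x p](nth_last x (x :: p)).
have lE : nth x (x :: rcons p w) (size p) = last x p.
  by rewrite nthE // -[last x p](nth_last x (x :: p)).
split=> [H | [H1 H2] i].
  split=> [i ip|].
    by have := H i; rewrite size_rcons ltnS (ltnW ip) vE // nthE ?(ltnW ip) //;
       apply.
  by have := H (size p); rewrite size_rcons vL lE; apply.
rewrite size_rcons ltnS leq_eqVlt => /predU1P[-> | ip]; first by rewrite vL lE.
by rewrite vE // nthE ?(ltnW ip) //; apply: H1.
Qed.

Lemma enters_rcons x p w : enters x (rcons p w) = e (last x p) w.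
Proof.
rewrite /enters size_rcons last_rcons /= -rcons_cons nth_rcons /= ltnSn.
by rewrite -[last x p](nth_last x (x :: p)).
Qed.

Lemma trail_rcons x p w :
  trail e x (rcons p w) = trail e x p && (e (last x p) w || e w (last x p)).
Proof. by rewrite /trail rcons_path. Qed.

Lemma active_open (D : {set T}) x p :
  active e D x p <-> open_inside (ancestors D) D x p /\ last x p \notin D.
Proof.
have vL : v_structure e x p (size p) = false by rewrite /v_structure ltnn andbF.
have lE : nth x (x :: p) (size p) = last x p.
  by rewrite -[last x p](nth_last x (x :: p)).
split=> [H | [H1 H2] i].
  split=> [i ip|]; last by have := H _ (leqnn _); rewrite vL lE.
  have := H i (ltnW ip); case: ifP => _ /=; last by rewrite inE.
  by move/ancestorsP.
rewrite leq_eqVlt => /predU1P[-> | ip]; first by rewrite vL lE.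
have := H1 i ip; case: ifP => _; last by rewrite inE.
by move/ancestorsP.
Qed.

Hypothesis arc_asym : forall u w, e u w -> ~~ e w u.

Lemma reach_walk (K D A : {set T}) u b : reach K D A u b ->
  exists x p, [/\ x \in A, last x p = u, trail e x p, open_inside K D x p &
    enters x p = b].
Proof.
elim=> {u b} [u uA | u b w _ [x [p [xA pu tp op bE]]] uD uw
  | u w _ [x [p [xA pu tp op bE]]] uD wu
  | u w _ [x [p [xA pu tp op bE]]] uK wu].
- by exists u, [::]; split=> // i.
- exists x, (rcons p w); split=> //; first by rewrite last_rcons.
  + by rewrite trail_rcons tp pu uw.
  + apply/open_inside_rcons; split=> //.
    by rewrite pu (negbTE (arc_asym uw)) andbF inE.
  + by rewrite enters_rcons pu uw.
- exists x, (rcons p w); split=> //; first by rewrite last_rcons.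
  + by rewrite trail_rcons tp pu wu orbT.
  + by apply/open_inside_rcons; split=> //; rewrite pu bE inE.
  + by rewrite enters_rcons pu (negbTE (arc_asym wu)).
- exists x, (rcons p w); split=> //; first by rewrite last_rcons.
  + by rewrite trail_rcons tp pu wu orbT.
  + by apply/open_inside_rcons; split=> //; rewrite pu bE wu.
  + by rewrite enters_rcons pu (negbTE (arc_asym wu)).
Qed.

Lemma walk_reach (K D A : {set T}) x p : x \in A -> trail e x p ->
  open_inside K D x p -> reach K D A (last x p) (enters x p).
Proof.
move=> xA; elim/last_ind: p => [|p w IH].
  by move=> _ _; apply: reach_start.
rewrite trail_rcons => /andP[tp pw] /open_inside_rcons[op lp].
have {IH tp op} := IH tp op; rewrite last_rcons enters_rcons.
case: (boolP (e (last x p) w)) pw lp => [uw _ | _ /= wu].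
  rewrite (negbTE (arc_asym uw)) andbF inE => uD r.
  exact: reach_forward r uD uw.
rewrite wu andbT; case: (enters x p) => [uK r | ].
  exact: reach_collider r uK wu.
by rewrite inE => uD r; apply: reach_backward r uD wu.
Qed.

Lemma d_separatedPn (A B D : {set T}) :
  ~ d_separated e A B D <->
  exists u b, [/\ reach (ancestors D) D A u b, u \in B & u \notin D].
Proof.
split=> [nsep | [u [b [r uB uD]]] sep].
  apply: contrapT => nr; apply: nsep => x p xA lB tp /active_open[op lD].
  by apply: nr; exists (last x p), (enters x p); split=> //; apply: walk_reach.
have [x [p [xA pu tp op _]]] := reach_walk r.
by apply: (sep x p xA _ tp); rewrite ?pu //; apply/active_open; rewrite pu.
Qed.

(* A collider outside [D] is bypassed by going down to its first descendant in
   [D] and back up again. *)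
Lemma reach_strict (D A : {set T}) u b :
  reach (ancestors D) D A u b -> reach D D A u b.
Proof.
have detour w : w \in ancestors D -> reach D D A w true ->
    forall a, e a w -> reach D D A a false.
  elim/ancestors_ind => [{}w wD r a | {}w w' ww' _ IH r a aw].
    exact: reach_collider.
  have [wD | wD] := boolP (w \in D); first exact: reach_collider r wD aw.
  have r' := reach_forward r wD ww'.
  exact: reach_backward (IH r' _ ww') wD aw.
elim=> {u b} [u uA | u b w _ r uD uw | u w _ r uD wu | u w _ r uK wu].
- exact: reach_start.
- exact: reach_forward r uD uw.
- exact: reach_backward r uD wu.
- exact: detour uK r _ wu.
Qed.

(** * Separation inside an ancestral set *)

Section Separation.
Variables (Z M : {set T}).
Let W := ancestors (Z :|: M).
Let reachM := reach (ancestors Z) Z M.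

(** Such a vertex is an ancestor of [M]; its directed path down to [M] avoids [Z], and climbing that
    path from [M] gives a walk that does not end with an arrow into [u]. *)
Lemma reach_no_arrow u : u \in W -> u \notin ancestors Z -> reachM u false.
Proof.
elim/ancestors_ind => {u} [u | u w uw _ IH uZ].
  rewrite inE => /orP[uZ | uM _]; last exact: reach_start.
  by rewrite (subsetP (sub_ancestors Z)).
have wZ : w \notin ancestors Z by apply: contraNN uZ; apply: ancestors_arc uw.
apply: reach_backward (IH wZ) _ uw.
by apply: contraNN wZ; apply: (subsetP (sub_ancestors Z)).
Qed.

(** A vertex entered by an arrow is either an open collider or not an ancestor of [Z]; in the latter
    case [reach_no_arrow] supplies a walk that can be continued upwards. *)
Lemma reach_parent u b w :
  u \in W -> reachM u b -> b || (u \notin Z) -> e w u -> reachM w false.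
Proof.
move=> uW; case: b => /= [r _ wu | r uZ wu]; last exact: reach_backward r uZ wu.
have [uZ | uZ] := boolP (u \in ancestors Z).
  exact: reach_collider r uZ wu.
apply: reach_backward (reach_no_arrow uW uZ) _ wu.
by apply: contraNN uZ; apply: (subsetP (sub_ancestors Z)).
Qed.

(* Separation in the moralised ancestral graph. *)
Lemma reach_family v a b c :
  v \in W -> (a == v) || e a v -> reachM a b -> a \notin Z ->
  (c == v) || e c v -> exists b', reachM c b'.
Proof.
move=> vW /predU1P[->|av] r aZ /predU1P[->|cv].
- by exists b.
- by exists false; apply: reach_parent vW r _ cv; rewrite aZ orbT.
- by exists true; apply: reach_forward r aZ av.
- by exists false; apply: reach_parent vW (reach_forward r aZ av) _ cv.
Qed.

End Separation.

(** The walk is restarted at each non-collider in [M]. After the last restart, at [v], non-colliders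
    avoid all of [C], and colliders remain open since [C :\: M] lies in [C :\ v]. *)
Lemma reach_split (C M : {set T}) u b : M \subset C ->
  reach (ancestors (C :\: M)) (C :\: M) M u b ->
  exists2 v, v \in M & reach (ancestors (C :\ v)) (C :\ v) [set v] u b.
Proof.
move=> MC; have outside w v : w \notin C :\: M -> w \notin M -> w \notin C :\ v.
  by rewrite !inE => /nandP[/negPn-> // | /negbTE->]; rewrite andbF.
have sub v : v \in M -> C :\: M \subset C :\ v.
  by move=> vM; apply: setDS; rewrite sub1set.
elim=> {u b} [u uM | u b w _ [v vM r] uD uw | u w _ [v vM r] uD wu
  | u w _ [v vM r] uK wu].
- by exists u => //; apply: reach_start; rewrite inE.
- have [uM | uM] := boolP (u \in M).
    exists u => //; apply: (reach_forward (u := u) (b := false)) uw.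
      by apply: reach_start; rewrite inE.
    by rewrite !inE eqxx.
  by exists v => //; apply: reach_forward r _ uw; apply: outside.
- have [uM | uM] := boolP (u \in M).
    exists u => //; apply: (reach_backward (u := u)) wu.
      by apply: reach_start; rewrite inE.
    by rewrite !inE eqxx.
  by exists v => //; apply: reach_backward r _ wu; apply: outside.
- exists v => //; apply: reach_collider r _ wu.
  exact: (subsetP (ancestorsS (sub _ vM))).
Qed.

End Walks.

(** * The augmented graph *)

Section Augmented.
Variable G : influence_diagram.
Implicit Types (A C D K M : {set vertex G}) (u v w : vertex G).

Lemma arc_asym u w : Defs.arc u w -> ~~ Defs.arc w u.
Proof.
move=> uw; apply/negP => wu.
by have := @arc_acyclic G [:: u; w]; rewrite /= uw wu => /(_ isT).
Qed.

Lemma augmented_arc_asym (a b : augmented_vertex G) :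
  augmented_arc a b -> ~~ augmented_arc b a.
Proof. by case: a b => [u|w] [v|w'] //=; apply: arc_asym. Qed.

Lemma mem_original D u : (inl u \in original D) = (u \in D).
Proof. by apply: mem_imset => x y []. Qed.

Lemma inr_original D (w : {w | w \in decision G}) :
  (inr w \in original D) = false.
Proof. by apply/imsetP => -[]. Qed.

Lemma original_setD C D : original (C :\: D) = original C :\: original D.
Proof.
by apply/setP => -[u|w]; rewrite in_setD ?mem_original ?inr_original ?inE.
Qed.

Lemma original_setU C D : original (C :|: D) = original C :|: original D.
Proof. exact: imsetU. Qed.

Lemma original_set1 u : original [set u] = [set inl u].
Proof. exact: imset_set1. Qed.

Lemma ancestors_original D u :
  u \in ancestors (@Defs.arc G) D ->
  inl u \in ancestors (@augmented_arc G) (original D).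
Proof.
elim/ancestors_ind => {u} [u uD | u w uw _ IH].
  by apply: (subsetP (sub_ancestors _ _)); rewrite mem_original.
by apply: (@ancestors_arc _ _ _ (inl u) (inl w)).
Qed.

(** An added vertex has one neighbour, the decision below it. The first alternative records a
    decision at which the walk may turn to its added parent: as a collider if entered by an arrow,
    as a non-collider otherwise. *)
Lemma reach_original K D A (a : augmented_vertex G) b :
  reach (@augmented_arc G) (original K) (original D) (original A) a b ->
  (exists u b', [/\ reach (@Defs.arc G) K D A u b', u \in decision G &
     u \in if b' then K else ~: D]) \/
  (exists2 u, a = inl u & reach (@Defs.arc G) K D A u b).
Proof.
elim=> {a b} [a /imsetP[u uA ->] | a b c _ [|[u -> r]] uD uw
  | a c _ [|[u -> r]] uD uw | a c _ [|[u -> r]] uK uw]; try by left.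
- by right; exists u => //; apply: reach_start.
- case: c uw => // w uw; right; exists w => //.
  by apply: reach_forward r _ uw; rewrite mem_original in uD.
- rewrite mem_original in uD; case: c uw => [w uw|w /= /eqP wu].
    by right; exists w => //; apply: reach_backward r uD uw.
  by left; exists u, false; rewrite -{2}wu (valP w) inE.
- rewrite mem_original in uK; case: c uw => [w uw|w /= /eqP wu].
    by right; exists w => //; apply: reach_collider r uK uw.
  by left; exists u, true; rewrite -{2}wu (valP w).
Qed.

Lemma not_Cperp_walk C v : v \in C -> v \notin Cperp C ->
  exists p : seq (vertex G), [/\ trail (@Defs.arc G) v p,
    open_inside (@Defs.arc G) (C :\ v) (C :\ v) v p, last v p \in decision G &
    last v p \in if enters (@Defs.arc G) v p then C :\ v else ~: (C :\ v)].
Proof.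
move=> vC; rewrite inE vC /= => /asboolPn.
move=> /(d_separatedPn augmented_arc_asym)[a [b [r aB _]]].
have {}r := reach_strict r.
have [[u [b' [r' udec uE]]]|[u uE _]] := reach_original r; last first.
  by move: aB; rewrite uE => /imsetP[].
have [x [p [/set1P-> pu tp op bE]]] := reach_walk arc_asym r'.
by exists p; rewrite bE pu.
Qed.

(** [S] collects the vertices outside [C :\: Cperp C] reached from [Cperp C]. By [reach_family], a
    vertex and its parents are all reached once one of them is in [S]; for a decision this would
    include its added parent, which [reach_split] rules out. *)
Lemma Cperp_separator C : exists S : {set vertex G},
  [/\ Cperp C \subset S, [disjoint S & C :\: Cperp C] &
   forall u v, v \in ancestors (@Defs.arc G) C -> u \in S ->
   (u == v) || Defs.arc u v ->
   v \notin decision G /\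
   forall u', (u' == v) || Defs.arc u' v -> u' \in S :|: (C :\: Cperp C)].
Proof.
set M := Cperp C; set Z := C :\: M.
have MC : M \subset C by apply/subsetP => v; rewrite inE => /andP[].
pose rch := reach (@augmented_arc G)
  (ancestors (@augmented_arc G) (original Z)) (original Z) (original M).
have no_theta (w : {w | w \in decision G}) b : ~ rch (inr w) b.
  rewrite /rch original_setD => r.
  have MC' : original M \subset original C by apply: imsetS.
  have [_ /imsetP[v vM ->] {}r] := reach_split MC' r.
  move: vM; rewrite inE => /andP[_ /asboolP sep]; move: sep.
  apply/(d_separatedPn augmented_arc_asym).
  exists (inr w), b; rewrite inr_original imset_f //; split=> //.
  by rewrite original_setD !original_set1.
exists [set u in ~: Z | `[< exists b, rch (inl u) b >]]; split.
- apply/subsetP => u uM; rewrite inE in_setC in_setD uM /=; apply/asboolP.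
  by exists false; apply: reach_start; rewrite mem_original.
- rewrite disjoint_subset; apply/subsetP => u.
  by rewrite inE in_setC => /andP[].
move=> u v vW; rewrite inE in_setC => /andP[uZ /asboolP[b r]] uv.
have closed c : (c == inl v) || augmented_arc c (inl v) -> exists b', rch c b'.
  move=> cv; refine (reach_family _ _ r _ cv) => //.
  - have := ancestors_original vW; congr (_ \in ancestors _ _).
    by rewrite -original_setU setUC -{1}(setID C M) (setIidPr MC).
  - by rewrite mem_original.
split.
  apply/negP => vdec; have [|b' r'] := closed (inr (Sub v vdec)).
    by rewrite /= eqxx.
  exact: no_theta r'.
move=> u' u'v; rewrite in_setU.
have [u'Z|u'Z] := boolP (u' \in Z); rewrite ?orbT // orbF.
rewrite inE in_setC u'Z /=; apply/asboolP.
exact: closed.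
Qed.

End Augmented.

Local Open Scope ring_scope.

(** * Marginals on ancestral sets *)

Section Assignments.
Variables (V : finType) (X : V -> finType).
Implicit Types (x y : full_assignment X) (A : {set V}).

Lemma restrictP A x y :
  reflect {in A, forall v, x v = y v} (restrict A x == restrict A y).
Proof.
apply: (iffP eqP) => [/ffunP xy v vA | xy].
  by have := xy (Sub v vA); rewrite !ffunE.
by apply/ffunP => -[v vA]; rewrite !ffunE /= xy.
Qed.

Definition update x v (a : X v) : full_assignment X :=
  [ffun u => dfwith x a u].

Lemma update_eq x v (a : X v) : update x a v = a.
Proof. by rewrite ffunE dfwith_in. Qed.

Lemma update_neq x v (a : X v) u : v != u -> update x a u = x u.
Proof. by move=> vu; rewrite ffunE dfwith_out. Qed.

Definition splice A x y : full_assignment X :=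
  [ffun u => if u \in A then x u else y u].

Lemma splice_in A x y v : v \in A -> splice A x y v = x v.
Proof. by move=> vA; rewrite ffunE vA. Qed.

Lemma splice_out A x y v : v \notin A -> splice A x y v = y v.
Proof. by move=> /negbTE vA; rewrite ffunE vA. Qed.

Lemma spliceK A x y : splice A (splice A x y) (splice A y x) = x.
Proof. by apply/ffunP => v; rewrite !ffunE; case: (v \in A). Qed.

Lemma assignment_gt0 A :
  (forall v, (0 < #|X v|)%N) -> (0 < #|assignment X A|)%N.
Proof.
move=> X0; have w v : X v by have /card_gt0P/sigW[] := X0 v.
by apply/card_gt0P; exists (restrict A [ffun v => w v]).
Qed.

End Assignments.

Section Marginalisation.
Variables (R : realType) (V : finType) (X : V -> finType) (e : rel V).
Hypothesis acyclic : forall c : seq V, cycle e c -> c = [::].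
Hypothesis X_gt0 : forall v, (0 < #|X v|)%N.
Implicit Types (x y : full_assignment X) (u v w : V) (W N : {set V}).

Lemma sum_update (F : full_assignment X -> R) v :
  \sum_x \sum_(a : X v) F (update x a) = \sum_x F x *+ #|X v|.
Proof.
rewrite pair_big /=.
(* This involution exchanges the new value with the old coordinate at [v]. *)
pose h (p : full_assignment X * X v) := (update p.1 p.2, p.1 v).
rewrite (reindex_inj (h := h)) /=; last first.
  apply: inv_inj => -[x a]; rewrite /h /= update_eq; congr (_, _).
  apply/ffunP => u; rewrite ffunE; case: dfwithP => // {}u vu.
  by rewrite update_neq.
rewrite -(pair_big xpredT xpredT (fun x a => F (update (update x a) (x v)))) /=.
apply: eq_bigr => x _; rewrite -sumr_const; apply: eq_big => // a _.
congr F; apply/ffunP => u; rewrite ffunE; case: dfwithP => // {}u vu.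
by rewrite update_neq.
Qed.

Variable q : full_assignment X -> forall v, X v -> R.
Hypothesis q_sum1 : forall x (v : V), \sum_(a : X v) q x a = 1.
Hypothesis q_local : forall x y (v : V) (a : X v),
  (forall u, e u v -> x u = y u) -> q x a = q y a.

Lemma arc_irrefl v : ~~ e v v.
Proof.
by apply/negP => vv; have := @acyclic [:: v]; rewrite /= vv => /(_ isT).
Qed.

Lemma q_update x v (a : X v) u (b : X u) : ~~ e v u -> q (update x a) b = q x b.
Proof.
move=> vu; apply: q_local => w wu; rewrite update_neq //.
by apply: contraNneq vu => ->.
Qed.

(** Summing the kernel at [v] gives 1, but the remaining sum still ranges over the coordinate at
    [v]; the factor [#|X v|%:R^-1] compensates for this repetition. *)
Lemma sum_out v (g : full_assignment X -> R) :
  (forall x (a : X v), g (update x a) = g x) ->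
  \sum_x q x (x v) * g x = #|X v|%:R^-1 * \sum_x g x.
Proof.
move=> gv; apply: (@mulfI _ #|X v|%:R); first by rewrite pnatr_eq0 -lt0n.
rewrite mulVKf ?pnatr_eq0 -?lt0n // mulr_natl -sumrMnl -sum_update.
apply: eq_bigr => x _; under eq_bigr => a _ do
  rewrite update_eq q_update ?arc_irrefl // gv.
by rewrite -big_distrl /= q_sum1 mul1r.
Qed.

(** By acyclicity [u] is not among the descendants of [v], all of which descend from [u]. *)
Lemma rank_arc u v : e u v -> (#|connect e v| < #|connect e u|)%N.
Proof.
move=> uv; apply: proper_card; apply/properP; split.
  apply/subsetP => w; rewrite !inE; exact: connect_trans (connect1 uv).
exists u; first by rewrite inE connect0.
rewrite inE; apply/negP => /connectP[p vp uE].
by have := @acyclic (v :: p); rewrite /= rcons_path vp -uE uv => /(_ isT).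
Qed.

Lemma exists_sink (N : {set V}) : N != set0 ->
  exists2 v, v \in N & forall u, u \in N -> ~~ e v u.
Proof.
case/set0Pn => v0 v0N; pose v := [arg min_(v < v0 in N) #|connect e v|].
exists v; rewrite /v; case: arg_minnP => // w wN wmin // u uN.
by apply/negP => /rank_arc; rewrite ltnNge wmin.
Qed.

Lemma sum_ancestral W (h : full_assignment X -> R) :
  (forall u v, e u v -> v \in W -> u \in W) ->
  (forall x v (a : X v), v \notin W -> h (update x a) = h x) ->
  \sum_x (\prod_v q x (x v)) * h x =
  (\prod_(v in ~: W) #|X v|%:R^-1) * \sum_x (\prod_(v in W) q x (x v)) * h x.
Proof.
move=> Wanc hW.
(* The complement of [W] is summed out one sink of [N] at a time. Since [W] is ancestral, such a
   sink has no child in [W] either, so no other remaining factor depends on it. *)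
suff sum_set n N : #|N| = n -> [disjoint N & W] ->
    (forall u v, e u v -> v \in W :|: N -> u \in W :|: N) ->
    \sum_x (\prod_(v in W :|: N) q x (x v)) * h x =
    (\prod_(v in N) #|X v|%:R^-1) * \sum_x (\prod_(v in W) q x (x v)) * h x.
  rewrite -(sum_set _ (~: W) erefl).
  - by apply: eq_bigr => x _; congr (_ * _); apply: eq_bigl => v;
      rewrite setUCr inE.
  - by rewrite -setI_eq0 setIC setICr.
  - by move=> u v; rewrite setUCr !inE.
elim: n N => [|n IH] N.
  move=> /eqP; rewrite cards_eq0 => /eqP-> _ _; rewrite setU0.
  by rewrite big_set0 mul1r.
move=> cN dN Nanc; have [|v vN vsink] := @exists_sink N.
  by rewrite -card_gt0 cN.
have vW : v \notin W by rewrite (disjointFr dN).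
have sink u : u \in W :|: N -> ~~ e v u.
  rewrite inE => /orP[uW|uN]; last exact: vsink.
  by apply: contra vW => vu; apply: Wanc vu uW.
have WN : (W :|: N) :\ v = W :|: (N :\ v).
  by apply/setP => u; rewrite !inE; case: eqP => // ->; rewrite (negbTE vW).
have split_v x : \prod_(u in W :|: N) q x (x u) =
    q x (x v) * \prod_(u in W :|: (N :\ v)) q x (x u).
  by rewrite (big_setD1 v) ?WN // inE vN orbT.
under [LHS]eq_bigr => x _ do rewrite split_v -mulrA.
rewrite sum_out; last first.
  move=> x a; rewrite hW //; congr (_ * _); apply: eq_bigr => u uW.
  have uv : v != u by apply: contraTneq uW => <-; rewrite !inE eqxx (negbTE vW).
  rewrite update_neq // q_update //; apply: sink.
  by move: uW; rewrite -WN => /setD1P[].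
rewrite (IH (N :\ v)); first by rewrite mulrA -big_setD1.
- by apply/eqP; rewrite -eqSS -cN (cardsD1 v N) vN.
- by apply: disjointWl dN; apply: subD1set.
- move=> u w uw; rewrite -!WN => /setD1P[wv wWN]; apply/setD1P; split.
    by apply: contraTneq uw => ->; apply: sink.
  exact: Nanc uw wWN.
Qed.

End Marginalisation.

(** * Policy invariance of C^perp *)

Section Mechanism.
Variables (R : realType) (G : influence_diagram) (P : parametrization R G).
Implicit Types (delta : policy P) (v : vertex G).
Implicit Types (x y : full_assignment (Defs.space P)).

Lemma not_decision v : v \notin decision G -> v \in nondecision G.
Proof. by rewrite inE. Qed.

(** One family indexed by all vertices turns [joint] into a single product, to which [sum_ancestral]
    applies. *)
Definition mechanism delta v :
    cond_dist R (Defs.space P v) (assignment (Defs.space P) (parents v)) :=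
  match pselect (v \in decision G) with
  | left vdec => delta (exist _ v vdec)
  | right vdec => Defs.law P (exist _ v (not_decision (introN idP vdec)))
  end.

Lemma mechanism_decision delta w : mechanism delta (val w) = delta w.
Proof.
case: w => v vdec; rewrite /mechanism; case: pselect => /= [vdec'|//].
by rewrite (bool_irrelevance vdec' vdec).
Qed.

Lemma mechanism_nondecision delta w : mechanism delta (val w) = Defs.law P w.
Proof.
case: w => v vdec; rewrite /mechanism; case: pselect => /= [vdec'|vdec'].
  by have := vdec; rewrite inE vdec'.
by rewrite (bool_irrelevance (not_decision (introN idP vdec')) vdec).
Qed.

Lemma joint_mechanism delta x :
  joint delta x = \prod_v mechanism delta v (restrict (parents v) x) (x v).
Proof.
rewrite (bigID (mem (nondecision G))) /= /joint; congr (_ * _).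
  rewrite [RHS]big_sub; apply: eq_bigr => w _.
  by rewrite mechanism_nondecision.
rewrite [RHS](eq_bigl (mem (decision G))); last by move=> v; rewrite !inE negbK.
rewrite [RHS]big_sub; apply: eq_bigr => w _.
by rewrite mechanism_decision.
Qed.

Lemma joint_ge0 delta x : 0 <= joint delta x.
Proof.
by rewrite joint_mechanism prodr_ge0 // => v _; apply: cond_dist_ge0.
Qed.

Lemma joint_neq0 delta x :
  reflect (forall v, mechanism delta v (restrict (parents v) x) (x v) != 0)
    (joint delta x != 0).
Proof.
rewrite joint_mechanism.
by apply: (iffP (prodf_neq0 _ _)) => H v; [apply: H | move=> _; apply: H].
Qed.

Lemma prob_ge0 delta E : 0 <= prob delta E.
Proof. by apply: sumr_ge0 => x _; apply: joint_ge0. Qed.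

Lemma prob_gt0 delta (E : pred (full_assignment (Defs.space P))) x :
  E x -> joint delta x != 0 -> 0 < prob delta E.
Proof.
move=> Ex jx; rewrite /prob (bigD1 x) //=.
apply: ltr_wpDr; last by rewrite lt_def jx joint_ge0.
by apply: sumr_ge0 => y _; apply: joint_ge0.
Qed.

Lemma sum_agrees delta A (E : pred (full_assignment (Defs.space P))) :
  \sum_(a : assignment (Defs.space P) A) prob delta (predI (agrees a) E) =
  prob delta E.
Proof.
rewrite /prob (exchange_big_dep E) => [|a x _ /andP[]] //=.
apply: eq_bigr => x Ex; rewrite (big_pred1 (restrict A x)) // => a.
by rewrite /= Ex andbT eq_sym.
Qed.

Lemma prob_ancestral delta (W : {set vertex G})
    (E : pred (full_assignment (Defs.space P))) :
  (forall u v, Defs.arc u v -> v \in W -> u \in W) ->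
  (forall x v (a : Defs.space P v), v \notin W -> E (update x a) = E x) ->
  prob delta E = (\prod_(v in ~: W) #|Defs.space P v|%:R^-1) *
    \sum_x (\prod_(v in W) mechanism delta v (restrict (parents v) x) (x v)) *
      (E x)%:R.
Proof.
move=> Wanc EW; rewrite /prob big_mkcond.
under eq_bigr => x _ do rewrite joint_mechanism -mulrb -mulr_natr.
pose q x v := mechanism delta v (restrict (parents v) x).
rewrite -(@sum_ancestral _ _ _ _ (@arc_acyclic G) (@space_nonempty _ _ P) q).
- by [].
- by move=> x v; apply: cond_dist_sum1.
- move=> x y v a xy; rewrite /q; congr (mechanism _ _ _ _).
  by apply/eqP/restrictP => u; rewrite inE => /xy.
- exact: Wanc.
- by move=> x v a vW; rewrite EW.
Qed.

Section Separator.
Variable C : {set vertex G}.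
Let M := Cperp C.
Let Z := C :\: M.

(* Exchanging, between two independent samples [x] and [y] agreeing on [Z],
   the coordinates outside the part separated from the decisions, exchanges
   the two policies. *)
Lemma prob_cross delta delta' (m : assignment (Defs.space P) M)
    (z : assignment (Defs.space P) Z) :
  prob delta (predI (agrees m) (agrees z)) * prob delta' (agrees z) =
  prob delta' (predI (agrees m) (agrees z)) * prob delta (agrees z).
Proof.
have [S [MS SZ fam]] := Cperp_separator C.
have MC : M \subset C by apply/subsetP => v; rewrite inE => /andP[].
set W := ancestors (@Defs.arc G) C in fam.
have Wanc u v : Defs.arc u v -> v \in W -> u \in W by apply: ancestors_arc.
have CW : C \subset W by apply: sub_ancestors.
have agrees_update A x v (a : Defs.space P v)
    (b : assignment (Defs.space P) A) :
    A \subset C -> v \notin W -> agrees b (update x a) = agrees b x.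
  move=> AC vW; congr (_ == _); apply/eqP/restrictP => u uA.
  rewrite update_neq //; apply: contraNneq vW => ->.
  by rewrite (subsetP CW) // (subsetP AC).
have ZC : Z \subset C by apply: subsetDl.
(* The events depend only on coordinates in [C], so only factors at ancestors of [C] remain, with
   the same constants on both sides. *)
rewrite !(@prob_ancestral _ W) //;
  try by move=> x v a vW; rewrite /= -!/(agrees _ _) ?agrees_update.
rewrite [LHS]mulrACA [RHS]mulrACA; congr (_ * _).
rewrite !big_distrlr /= !pair_big /=.
pose h (p : full_assignment (Defs.space P) * full_assignment (Defs.space P)) :=
  (splice S p.1 p.2, splice S p.2 p.1).
rewrite (reindex_inj (h := h)) /=; last first.
  by apply: inv_inj => -[x y]; rewrite /h /= !spliceK.
apply: eq_bigr => -[x y] _ /=.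
have mE : agrees m (splice S x y) = agrees m x.
  congr (_ == _); apply/eqP/restrictP => u uM.
  by rewrite splice_in // (subsetP MS).
have zE x1 y1 : agrees z (splice S x1 y1) = agrees z y1.
  congr (_ == _); apply/eqP/restrictP => u uZ.
  by rewrite splice_out // (disjointFl SZ).
rewrite mE !zE [LHS]mulrACA [RHS]mulrACA -!natrM !mulnb.
rewrite [in RHS]andbAC -[in RHS]andbA -[in LHS]andbA.
have [/andP[mx /andP[zy zx]]|] := boolP (_ && _); last first.
  by move=> _; rewrite !mulr0.
rewrite !mulr1 -!big_split /=; apply: eq_bigr => v vW.
have xyZ : {in Z, forall u, x u = y u}.
  by apply/restrictP; rewrite (eqP zx) (eqP zy).
(* A factor that involves [S] sees only [S] and [Z], where the exchange changes nothing, and belongs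
   to no decision. Any other factor sees only exchanged coordinates, so there [delta] and [delta']
   trade samples. *)
have [/existsP[u /andP[uS uv]] | noS] :=
    boolP [exists u, (u \in S) && ((u == v) || Defs.arc u v)].
  have [vdec fS] := fam u v vW uS uv.
  have keep x1 y1 u' : {in Z, forall u, x1 u = y1 u} ->
      (u' == v) || Defs.arc u' v -> splice S x1 y1 u' = x1 u'.
    move=> xy1 u'v; have [u'S | u'S] := boolP (u' \in S).
      by rewrite splice_in.
    by have := fS u' u'v; rewrite splice_out // inE (negbTE u'S) => /xy1.
  have mech_keep x1 y1 d : {in Z, forall u, x1 u = y1 u} ->
    mechanism d v (restrict (parents v) (splice S x1 y1)) (splice S x1 y1 v) =
    mechanism d v (restrict (parents v) x1) (x1 v).
    move=> xy1; rewrite keep ?eqxx //; congr (mechanism _ _ _ _).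
    by apply/eqP/restrictP => u'; rewrite inE => u'v; rewrite keep ?u'v ?orbT.
  rewrite !mech_keep // => [|w wZ]; last by rewrite xyZ.
  suff -> : mechanism delta v = mechanism delta' v by [].
  by rewrite !(mechanism_nondecision _ (exist _ v (not_decision vdec))).
have swap x1 y1 u' : (u' == v) || Defs.arc u' v -> splice S x1 y1 u' = y1 u'.
  move=> u'v; rewrite splice_out //; apply: contraNN noS => u'S.
  by apply/existsP; exists u'; rewrite u'S.
have mech_swap x1 y1 d :
  mechanism d v (restrict (parents v) (splice S x1 y1)) (splice S x1 y1 v) =
  mechanism d v (restrict (parents v) y1) (y1 v).
  rewrite swap ?eqxx //; congr (mechanism _ _ _ _).
  by apply/eqP/restrictP => u'; rewrite inE => u'v; rewrite swap ?u'v ?orbT.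
by rewrite !mech_swap mulrC.
Qed.

End Separator.
End Mechanism.

(** * Uniform distributions on nonempty sets *)

Section Uniform.
Variables (R : realType) (A B : finType) (ok : B -> pred A).
Hypothesis ok_neq0 : forall b, exists a, ok b a.

Lemma uniform_ge0 b a : 0 <= (ok b a)%:R / #|ok b|%:R :> R.
Proof. by rewrite divr_ge0. Qed.

Lemma uniform_sum1 b : \sum_a (ok b a)%:R / #|ok b|%:R = 1 :> R.
Proof.
have -> : \sum_a (ok b a)%:R / #|ok b|%:R = #|ok b|%:R / #|ok b|%:R :> R.
  rewrite -big_distrl /= -{2}sum1_card natr_sum [in RHS]big_mkcond /=.
  by congr (_ / _); apply: eq_bigr => a _; rewrite unfold_in; case: (ok b a).
have [a oka] := ok_neq0 b.
by rewrite divff // pnatr_eq0 -lt0n; apply/card_gt0P; exists a.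
Qed.

Definition uniform : cond_dist R A B := CondDist uniform_ge0 uniform_sum1.

Lemma uniform_neq0 b a : (uniform b a != 0) = ok b a.
Proof.
rewrite mulf_eq0 invr_eq0 !pnatr_eq0 eqb0 negb_or negbK andb_idr // => oka.
by rewrite -lt0n; apply/card_gt0P; exists a.
Qed.

End Uniform.

Lemma Cperp_policy_invariant (R : realType) (G : influence_diagram)
    (C : {set vertex G}) : policy_invariant R C (Cperp C).
Proof.
split; first by apply/subsetP => v; rewrite inE => /andP[].
move=> P; set M := Cperp C; set Z := C :\: M.
have M0 := assignment_gt0 M (@space_nonempty _ _ P).
have unif :
    cond_dist R (assignment (Defs.space P) M) (assignment (Defs.space P) Z).
  apply: (@uniform R _ _ (fun _ => xpredT)) => _.
  by have /card_gt0P[a _] := M0; exists a.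
pose positive z (d : policy P) := 0 < prob d (agrees (A := Z) z).
(* [k] is read off from some policy giving [z] positive probability; by [prob_cross] the choice does
   not matter. Where there is none, [unif] serves as default. *)
pose k z m := match pselect (exists d, positive z d) with
  | left h => cond_prob (projT1 (cid h)) (agrees (A := M) m) (agrees z)
  | right _ => unif z m end.
have k_ge0 z m : 0 <= k z m.
  rewrite /k; case: pselect => h; last exact: cond_dist_ge0.
  by rewrite divr_ge0 ?prob_ge0.
have k_sum1 z : \sum_m k z m = 1.
  rewrite /k; case: pselect => h; last exact: cond_dist_sum1.
  rewrite /cond_prob -big_distrl /= sum_agrees divff //.
  by case: (cid h) => d /= /lt0r_neq0.
exists (CondDist k_ge0 k_sum1) => delta m z pos /=.
rewrite /k; case: pselect => [h|[]]; last by exists delta.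
case: (cid h) => d /= dpos; apply/eqP.
rewrite /cond_prob eqr_div ?lt0r_neq0 //; apply/eqP.
exact: prob_cross.
Qed.

(** * Maximality of C^perp *)

Section XorParametrization.
Variables (R : realType) (G : influence_diagram) (D : {set vertex G}).
Variables (v : vertex G) (p : seq (vertex G)).
Let n := size p.
Let t := nth v (v :: p).

Hypothesis p_trail : trail (@Defs.arc G) v p.
Hypothesis p_open : open_inside (@Defs.arc G) D D v p.
Hypothesis p_decision : last v p \in decision G.
Hypothesis p_last :
  last v p \in if enters (@Defs.arc G) v p then D else ~: D.

(** These tell whether the adjacent arcs of the walk point into position [i]. To the right of the
    last position stands the added parent of the decision, whence the value [true] there. *)
Let arc_left i := (0 < i)%N && Defs.arc (t i.-1) (t i).
Let arc_right (i : nat) := if i == n then true else Defs.arc (t i.+1) (t i).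

Lemma t_last : t n = last v p.
Proof. by rewrite /t -[last v p](nth_last v (v :: p)). Qed.

(** The walk has its colliders in [D] itself, not merely among its ancestors, so being observed
    amounts to being a collider. *)
Lemma t_mem i : (i <= n)%N -> (t i \in D) = arc_left i && arc_right i.
Proof.
rewrite leq_eqVlt /arc_left /arc_right => /predU1P[-> | ltin].
  rewrite eqxx andbT t_last; move: p_last; rewrite /enters.
  by case: ifP; rewrite ?inE // => _ /negbTE.
rewrite ltn_eqF // -andbA; have := p_open ltin; rewrite /v_structure ltin /=.
by rewrite -/t; case: ifP; rewrite ?inE // => _ /negbTE.
Qed.

Lemma t_step i : (i < n)%N ->
  Defs.arc (t i) (t i.+1) || Defs.arc (t i.+1) (t i).
Proof. by move=> ltin; apply: (pathP v p_trail). Qed.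

Lemma t_right i : (i < n)%N -> Defs.arc (t i.+1) (t i) -> t i.+1 \notin D.
Proof.
move=> ltin /arc_asym ra; rewrite t_mem // /arc_left /=.
by rewrite (negbTE ra).
Qed.

Lemma t_left i : (i < n)%N -> Defs.arc (t i) (t i.+1) -> t i \notin D.
Proof.
move=> ltin /arc_asym ra; rewrite t_mem ?(ltnW ltin) // /arc_right ltn_eqF //.
by rewrite (negbTE ra) andbF.
Qed.

(* The position after the last one stands for the added parent of the final
   decision; [b] is its value. *)
Definition wanted (b : bool) (val : nat -> bool) (self : bool) i :=
  let r := if i == n then b else val i.+1 in
  if arc_left i then if arc_right i then val i.-1 (+) r else val i.-1
  else if arc_right i then r else self.

(** Backward induction along the walk. An unobserved bit fed from the right copies its successor.
    Otherwise it feeds position [i.+1], which either copies it or is a collider whose observed 0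
    forces its two parents to agree. *)
Lemma wanted_propagates b val :
  (forall i, (i <= n)%N -> val i = wanted b val (val i) i) ->
  (forall i, (i <= n)%N -> t i \in D -> val i = false) ->
  forall i, (i <= n)%N -> t i \notin D -> val i = b.
Proof.
move=> cons obs i; have [k] := ubnP (n - i); elim: k i => // k IH i.
rewrite ltnS => ik lein tiD.
have := cons i lein; rewrite /wanted.
move: (tiD); rewrite t_mem //; move: lein ik; rewrite leq_eqVlt.
move=> /predU1P[-> _|ltin ik].
  by rewrite /arc_right eqxx andbT => /negbTE->.
have ik' : (n - i.+1 < k)%N by rewrite subnSK.
have [ri|ri] := boolP (arc_right i).
  rewrite andbT ltn_eqF // => /negbTE-> ->; apply: IH => //.
  by apply: t_right => //; move: ri; rewrite /arc_right ltn_eqF.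
move=> _ _; have li : Defs.arc (t i) (t i.+1).
  move: (t_step ltin) ri; rewrite /arc_right ltn_eqF //.
  by case: (Defs.arc (t i) _) => //= ->.
have := cons i.+1 ltin; rewrite /wanted {1}/arc_left /= li.
have [ri1|ri1] := boolP (arc_right i.+1); last first.
  move=> <-; apply: IH => //.
  by rewrite t_mem // (negbTE ri1) andbF.
rewrite obs ?t_mem ?ri1 ?andbT //=.
case: eqP ri1 => [_ _|/eqP ni]; first by case: (val i); case: (b).
rewrite /arc_right (negbTE ni) => ri1.
have ltin1 : (i.+1 < n)%N by rewrite ltn_neqAle ni.
rewrite (IH i.+2) //; first by case: (val i); case: (b).
  by apply: leq_trans ik'; rewrite ltnS leq_sub2l.
exact: t_right.
Qed.

(** Parents along the walk are non-colliders, hence carry [b]: copies are [b], and the xor of two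
    equal bits is the 0 observed at a collider. *)
Lemma wanted_witness b i : (i <= n)%N ->
  b && (t i \notin D) =
    wanted b (fun j => b && (t j \notin D)) (b && (t i \notin D)) i.
Proof.
move=> lein; rewrite /wanted.
have left_val : arc_left i -> t i.-1 \notin D.
  case: i lein => // i lein; rewrite /arc_left /= => li.
  exact: t_left.
have right_val : i != n -> arc_right i -> t i.+1 \notin D.
  move=> ni; rewrite /arc_right (negbTE ni) => ri.
  by apply: t_right => //; rewrite ltn_neqAle ni.
have tiD := t_mem lein.
case li: (arc_left i) in tiD *; case ri: (arc_right i) in tiD *;
  rewrite /= in tiD; rewrite ?left_val ?tiD //= ?andbF ?andbT.
- by case: eqP => [|/eqP ni]; rewrite ?right_val ?andbT ?addbb.
- by case: eqP => // /eqP ni; rewrite right_val ?andbT.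
Qed.

(** The walk may visit a vertex several times, so each vertex carries a separate bit for every
    position. *)
Let B : finType := n.+1.-tuple bool.
Let X (u : vertex G) : finType := B.

Definition read (A : {set vertex G}) (a : assignment X A) u j : bool :=
  if insub u is Some s then nth false (a s : B) j else false.

Lemma read_restrict (A : {set vertex G}) (x : full_assignment X) u j :
  u \in A ->
  read (restrict A x) u j = nth false (x u : B) j.
Proof. by move=> uA; rewrite /read insubT ffunE. Qed.

(** Bits at positions not occupied by [u] are unconstrained, and a bit without parents on the walk
    is compared with itself; under the uniform law these are the fair coins. *)
Definition consistent b u (a : assignment X (parents u)) : pred B :=
  fun y => [forall i : 'I_n.+1, (t i == u) ==>
    (nth false y i == wanted b (fun j => read a (t j) j) (nth false y i) i)].

Lemma consistent_ex b u (a : assignment X (parents u)) :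
  exists y, consistent b a y.
Proof.
exists [tuple wanted b (fun j => read a (t j) j) false i | i < n.+1].
apply/forallP => i; apply/implyP => _.
rewrite -!tnth_nth tnth_mktuple /wanted.
by case: (arc_left i); case: (arc_right i).
Qed.

(** [b] enters only at the last position, a decision. Hence the laws built with [false] in
    [xor_parametrization] fit both policies. *)
Lemma consistent_decision b b' u (a : assignment X (parents u)) :
  u \notin decision G -> consistent b a =1 consistent b' a.
Proof.
move=> und y; apply: eq_forallb => i; apply: implyb_id2l => /eqP tu.
rewrite /wanted; case: (@eqP _ (nat_of_ord i) n) => // ni.
by case/negP: und; rewrite -tu ni t_last.
Qed.

Lemma consistentP b (x : full_assignment X) :
  (forall u, consistent b (restrict (parents u) x) (x u)) <->
  (forall i, (i <= n)%N -> nth false (x (t i) : B) i =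
     wanted b (fun j => nth false (x (t j) : B) j)
       (nth false (x (t i) : B) i) i).
Proof.
(* [wanted] reads other positions only where their vertices are parents of [u], so restricting to
   the parents loses no bit. *)
have wantedE u (i : 'I_n.+1) s : t i = u ->
    wanted b (fun j => read (restrict (parents u) x) (t j) j) s i =
    wanted b (fun j => nth false (x (t j) : B) j) s i.
  move=> <-; rewrite /wanted.
  case li: (arc_left i); case ri: (arc_right i) => //.
  - rewrite read_restrict ?inE; last by case/andP: li.
    move: ri; rewrite /arc_right; case: eqP => // _ ri.
    by rewrite read_restrict ?inE.
  - by rewrite read_restrict ?inE; last by case/andP: li.
  - move: ri; rewrite /arc_right; case: eqP => // _ ri.
    by rewrite read_restrict ?inE.
split=> [cons i lein | cons u].
  have /forallP/(_ (Ordinal (lein : (i < n.+1)%N))) := cons (t i).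
  by rewrite eqxx wantedE // => /eqP.
apply/forallP => i; apply/implyP => /eqP tu.
by rewrite wantedE // -tu -cons // -ltnS.
Qed.

Definition xor_law b u : cond_dist R (X u) (assignment X (parents u)) :=
  uniform R (@consistent_ex b u).

Lemma bits_gt0 (u : vertex G) : (0 < #|X u|)%N.
Proof. by rewrite card_tuple expn_gt0 card_bool. Qed.

Definition xor_parametrization : parametrization R G :=
  @Parametrization R G X bits_gt0 (fun w => xor_law false (val w))
    (fun _ _ => 0).

Definition xor_policy b : policy xor_parametrization :=
  fun w => xor_law b (val w).

Lemma xor_joint b (x : full_assignment X) :
  (@joint R G xor_parametrization (xor_policy b) x != 0) <->
  (forall i, (i <= n)%N -> nth false (x (t i) : B) i =
     wanted b (fun j => nth false (x (t j) : B) j)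
       (nth false (x (t i) : B) i) i).
Proof.
rewrite -consistentP; split=> [/joint_neq0 H u | H].
  have := H u; have [udec|und] := boolP (u \in decision G).
    by rewrite (mechanism_decision _ (exist _ u udec)) uniform_neq0.
  rewrite (mechanism_nondecision _ (exist _ u (not_decision und))) uniform_neq0.
  by rewrite (consistent_decision _ b).
apply/joint_neq0 => u; have [udec|und] := boolP (u \in decision G).
  by rewrite (mechanism_decision _ (exist _ u udec)) uniform_neq0.
rewrite (mechanism_nondecision _ (exist _ u (not_decision und))) uniform_neq0.
by rewrite (consistent_decision _ b).
Qed.

Definition witness b : full_assignment X :=
  [ffun u => [tuple b && (u \notin D) | i < n.+1] : X u].

Lemma witness_nth b u i : (i <= n)%N ->
  nth false (witness b u : B) i = b && (u \notin D).
Proof.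
move=> lein; rewrite ffunE.
by rewrite -(tnth_nth _ _ (Ordinal (lein : (i < n.+1)%N))) tnth_mktuple.
Qed.

Lemma witness_joint b :
  @joint R G xor_parametrization (xor_policy b) (witness b) != 0.
Proof.
apply/xor_joint => i lein; rewrite witness_nth // wanted_witness //.
rewrite /wanted; case li: (arc_left i); case ri: (arc_right i) => //.
- rewrite witness_nth; last exact: leq_trans (leq_pred i) lein.
  congr (_ (+) _); case: eqP => // /eqP ni.
  by rewrite witness_nth // ltn_neqAle ni.
- by rewrite witness_nth //; apply: leq_trans (leq_pred i) lein.
- case: eqP => // /eqP ni.
  by rewrite witness_nth // ltn_neqAle ni.
Qed.

Lemma witness_observed b b' u : u \in D -> witness b u = witness b' u.
Proof.
move=> uD; rewrite !ffunE; apply: eq_from_tnth => i.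
by rewrite !tnth_mktuple uD !andbF.
Qed.

(** Position 0 of the walk is [v] itself, so its bit there is forced to be [true]. *)
Lemma xor_determines (x : full_assignment X) :
  @joint R G xor_parametrization (xor_policy true) x != 0 ->
  {in D, forall u, x u = witness false u} -> v \notin D ->
  x v <> witness false v.
Proof.
move=> /xor_joint cons xD vD xv.
have obs i : (i <= n)%N -> t i \in D -> nth false (x (t i) : B) i = false.
  by move=> lein tD; rewrite xD // witness_nth.
have := wanted_propagates cons obs (leq0n n) vD.
by rewrite -[t 0]/v xv witness_nth.
Qed.

Lemma walk_not_invariant (C M : {set vertex G}) :
  D = C :\ v -> v \in M -> ~ policy_invariant R C M.
Proof.
move=> DE vM [MC /(_ xor_parametrization)[k kP]].
have vD : v \notin D by rewrite DE !inE eqxx.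
have CMD u : u \in C :\: M -> u \in D.
  rewrite DE !inE => /andP[uM ->]; rewrite andbT.
  by apply: contraNneq uM => ->.
pose z : assignment (Defs.space xor_parametrization) (C :\: M) :=
  restrict (C :\: M) (witness false).
pose m : assignment (Defs.space xor_parametrization) M :=
  restrict M (witness false).
have zE b : restrict (C :\: M) (witness b) = z.
  by apply/eqP/restrictP => u /CMD; apply: witness_observed.
(* The two witnesses agree on [D], so the same [z] has positive probability under both policies. *)
have pos b : 0 < @prob R G xor_parametrization (xor_policy b) (agrees z).
  by apply: prob_gt0 (witness_joint b); apply/eqP/zE.
have := kP (xor_policy true) m z (pos true).
rewrite -(kP (xor_policy false) m z (pos false)) /cond_prob.
(* Together with [z], the value [m] is impossible under the policy [true] but possible under
   [false], so no single [k] fits both. *)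
have -> : prob (xor_policy true) (predI (agrees m) (agrees z)) = 0.
  apply: big1 => x /andP[/restrictP xm /restrictP xz].
  apply/eqP/negPn/negP => /xor_determines; apply=> // [u uD|]; last exact: xm.
  have [uM|uM] := boolP (u \in M); first exact: xm.
  by apply: xz; rewrite in_setD uM; move: uD; rewrite DE => /setD1P[].
rewrite mul0r => /esym/eqP; rewrite mulf_eq0 invr_eq0 !gt_eqF //.
by apply: prob_gt0 (witness_joint false); apply/andP; split; apply/eqP.
Qed.

End XorParametrization.

Theorem theorem3 (R : realType) (G : influence_diagram)
    (C : {set vertex G}) :
  exists M : {set vertex G},
    unique (@largest_policy_invariant R G C) M /\ M = Cperp C.
Proof.
have max D : policy_invariant R C D -> D \subset Cperp C.
  move=> inv; apply/subsetP => v vD; apply: contrapT => /negP vperp.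
  have vC : v \in C by have [/subsetP->] := inv.
  have [p [tp op dp lp]] := not_Cperp_walk vC vperp.
  exact: (walk_not_invariant tp op dp lp erefl vD inv).
exists (Cperp C); split=> //; split.
  by split=> //; apply: Cperp_policy_invariant.
move=> N [invN maxN]; apply/eqP; rewrite eqEsubset max // andbT.
exact/maxN/Cperp_policy_invariant.
Qed.
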